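(* Let $A$ be a congruence-distributive algebra. Then $A$ has FCLP if and only if $A$ is FC-normal.
   Context: Algebras are non-empty universal algebras of a fixed arbitrary signature. For an algebra $A$, $\mathrm{Con}(A)$ is the bounded lattice of congruences of $A$ ordered by inclusion, with meet $\cap$, join $\phi\vee\psi$ = the congruence generated by $\phi\cup\psi$, least element $\Delta_A=\{(a,a)\mid a\in A\}$ and greatest element $\nabla_A=A^2$. $A$ is congruence-distributive if the lattice $\mathrm{Con}(A)$ is distributive; quotients of congruence-distributive algebras are congruence-distributive. Composition: $\phi\circ\psi=\{(a,b)\in A^2\mid \exists x\in A,\ (a,x)\in\psi,\ (x,b)\in\phi\}$. Let $A$ be congruence-distributive. A congruence $\phi$ of $A$ is a factor congruence if there is $\phi^*\in\mathrm{Con}(A)$ with $\phi\vee\phi^*=\nabla_A$, $\phi\cap\phi^*=\Delta_A$ and $\phi\circ\phi^*=\phi^*\circ\phi$. $\mathrm{FC}(A)$ is the set of factor congruences; it is a Boolean sublattice of $\mathrm{Con}(A)$. For $\theta\in\mathrm{Con}(A)$ and $\alpha\in\mathrm{Con}(A)$ with $\theta\subseteq\alpha$, $\alpha/\theta=\{(a/\theta,b/\theta)\mid (a,b)\in\alpha\}\in\mathrm{Con}(A/\theta)$. The map $u_\theta:\mathrm{Con}(A)\to\mathrm{Con}(A/\theta)$, $u_\theta(\alpha)=(\alpha\vee\theta)/\theta$, is a bounded lattice morphism which maps $\mathrm{FC}(A)$ into $\mathrm{FC}(A/\theta)$. The congruence $\theta$ has FCLP (Factor Congruence Lifting Property) if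 the restriction $u_\theta|:\mathrm{FC}(A)\to\mathrm{FC}(A/\theta)$ is surjective. $A$ has FCLP if every congruence of $A$ has FCLP. $A$ is FC-normal if, for all $\phi,\psi\in\mathrm{Con}(A)$ with $\phi\circ\psi=\nabla_A$, there exist $\alpha,\beta\in\mathrm{FC}(A)$ such that $\alpha\cap\beta=\Delta_A$ and $\phi\circ\alpha=\psi\circ\beta=\nabla_A$. *)

(* Defs.v *)
From HB Require Import structures.
From mathcomp Require Import all_boot all_order.
From mathcomp Require Import boolp classical_sets functions.

Set Implicit Arguments.
Unset Strict Implicit.
Unset Printing Implicit Defensive.

Import Order.Theory.
Local Open Scope classical_set_scope.
Local Open Scope quotient_scope.

Record signature := Signature {
  symbol : Type;
  arity : symbol -> nat }.

Record algebra (S : signature) := Algebra {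
  carrier :> Type;
  carrier_inhabited : inhabited carrier;
  op : forall f : symbol S, ('I_(arity f) -> carrier) -> carrier }.

Record is_congruence (S : signature) (A : algebra S) (R : set (A * A)) : Prop :=
  IsCongruence {
    congr_refl : forall a, R (a, a);
    congr_sym : forall a b, R (a, b) -> R (b, a);
    congr_trans : forall a b c, R (a, b) -> R (b, c) -> R (a, c);
    congr_op : forall (f : symbol S) (x y : 'I_(arity f) -> A),
      (forall i, R (x i, y i)) -> R (op x, op y) }.

Record con (S : signature) (A : algebra S) := Con {
  con_rel :> set (A * A);
  con_congr : is_congruence con_rel }.

Fact con_display : Order.disp_t. Proof. exact: Order.Disp tt tt. Qed.

Section CongruenceLattice.
Variables (S : signature) (A : algebra S).
Implicit Types (phi psi chi : con A).

Lemma con_inj phi psi : con_rel phi = con_rel psi -> phi = psi.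
Proof.
case: phi psi => [R cR] [R' cR'] /= eRR'; rewrite -{}eRR' in cR' *.
by rewrite (Prop_irrelevance cR cR').
Qed.

Lemma diagonal_congr : is_congruence (@diagonal A).
Proof.
split=> [a|a b /= ab|a b c /= ab bc|f x y xy].
- by [].
- by symmetry.
- by transitivity b.
- by congr (op _); apply/funext => i; exact: (xy i).
Qed.

Lemma setT_congr : is_congruence [set: A * A].
Proof. by []. Qed.

Lemma setI_congr phi psi : is_congruence (con_rel phi `&` con_rel psi).
Proof.
case: phi psi => [R [Rr Rs Rt Ro]] [R' [R'r R's R't R'o]] /=.
split=> [a|a b [ab ab']|a b c [ab ab'] [bc bc']|f x y xy]; split.
- exact: Rr.
- exact: R'r.
- exact: Rs.
- exact: R's.
- exact: Rt ab bc.
- exact: R't ab' bc'.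
- by apply: Ro => i; have [] := xy i.
- by apply: R'o => i; have [] := xy i.
Qed.

Lemma smallest_congr (X : set (A * A)) :
  is_congruence (smallest (@is_congruence S A) X).
Proof.
split=> [a R [[]] //|a b ab R RX|a b c ab bc R RX|f x y xy R RX].
- by apply: (congr_sym RX.1); exact: ab.
- by apply: (congr_trans RX.1 (b := b)); [exact: ab|exact: bc].
- by apply: (congr_op RX.1) => i; exact: xy.
Qed.

Definition con_bot : con A := Con diagonal_congr.
Definition con_top : con A := Con setT_congr.
Definition con_meet phi psi : con A := Con (setI_congr phi psi).
Definition con_join phi psi : con A :=
  Con (smallest_congr (con_rel phi `|` con_rel psi)).
Definition con_le phi psi : bool := `[< con_rel phi `<=` con_rel psi >].

Lemma con_le_refl : reflexive con_le.
Proof. by move=> phi; exact/asboolP. Qed.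

Lemma con_le_anti : antisymmetric con_le.
Proof.
move=> phi psi /andP[/asboolP le1 /asboolP le2].
by apply: con_inj; apply/seteqP.
Qed.

Lemma con_le_trans : transitive con_le.
Proof.
move=> psi phi chi /asboolP le1 /asboolP le2.
exact/asboolP/(subset_trans le1).
Qed.

Lemma con_le_meet phi psi chi :
  con_le phi (con_meet psi chi) = con_le phi psi && con_le phi chi.
Proof.
apply/asboolP/andP => [|[/asboolP ? /asboolP ?]]; rewrite /= subsetI //.
by move=> [? ?]; split; exact/asboolP.
Qed.

Lemma con_join_le phi psi chi :
  con_le (con_join phi psi) chi = con_le phi chi && con_le psi chi.
Proof.
apply/asboolP/andP => [le_chi|[/asboolP le1 /asboolP le2]].
  by split; apply/asboolP; apply: subset_trans le_chi => /= p p_in;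
    apply: sub_gen_smallest; [left|right].
by apply: smallest_sub; [exact: con_congr|rewrite subUset].
Qed.

Lemma con_bot_le phi : con_le con_bot phi.
Proof. by apply/asboolP => -[a b] /= ab; rewrite (_ : a = b)//; exact: congr_refl (con_congr phi) b. Qed.

Lemma con_le_top phi : con_le phi con_top.
Proof. exact/asboolP. Qed.

HB.instance Definition _ := gen_eqMixin (con A).
HB.instance Definition _ := gen_choiceMixin (con A).
HB.instance Definition _ := Order.Le_isPOrder.Build con_display (con A)
  con_le_refl con_le_anti con_le_trans.
HB.instance Definition _ := Order.POrder_MeetJoin_isLattice.Build
  con_display (con A) con_le_meet con_join_le.
HB.instance Definition _ :=
  Order.hasBottom.Build con_display (con A) con_bot_le.
HB.instance Definition _ :=
  Order.hasTop.Build con_display (con A) con_le_top.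

Lemma con_leP phi psi :
  reflect (con_rel phi `<=` con_rel psi) (phi <= psi)%O.
Proof. exact: asboolP. Qed.

(* [R \; R'] relates [a] to [b] when [R' (a, x)] and [R (x, b)] for some [x]. *)
Definition con_comp phi psi : set (A * A) :=
  (con_rel phi \; con_rel psi)%relation.

Definition factor_congruence phi : Prop :=
  exists phi' : con A,
    [/\ (phi `|` phi')%O = \top%O,
        (phi `&` phi')%O = \bot%O
      & con_comp phi phi' = con_comp phi' phi].

Definition FC : set (con A) := [set phi | factor_congruence phi].

Definition congruence_distributive : Prop :=
  forall phi psi chi,
    (phi `&` (psi `|` chi) = (phi `&` psi) `|` (phi `&` chi))%O.

End CongruenceLattice.

Arguments FC {S} A.

Section Quotient.
Variables (S : signature) (A : algebra S) (theta : con A).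

Definition con_bool_rel : rel {classic A} :=
  fun a b => `[< con_rel theta (a, b) >].

Lemma con_bool_rel_refl : reflexive con_bool_rel.
Proof. by move=> a; apply/asboolP; exact: congr_refl (con_congr theta) a. Qed.

Lemma con_bool_rel_sym : symmetric con_bool_rel.
Proof.
by move=> a b; apply/asboolP/asboolP => ?; exact: congr_sym (con_congr theta) _ _ _.
Qed.

Lemma con_bool_rel_trans : transitive con_bool_rel.
Proof.
move=> b a c /asboolP ab /asboolP bc.
exact/asboolP/(congr_trans (con_congr theta) ab bc).
Qed.

Canonical con_equiv_rel : equiv_rel {classic A} :=
  EquivRel con_bool_rel con_bool_rel_refl con_bool_rel_sym con_bool_rel_trans.

Definition quot_carrier : Type := {eq_quot con_equiv_rel}.

Definition quot_pi (a : A) : quot_carrier := \pi_({eq_quot con_equiv_rel}) a.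

Definition quot_repr (c : quot_carrier) : A :=
  repr (c : {eq_quot con_equiv_rel}).

Lemma quot_reprK : cancel quot_repr quot_pi.
Proof. by move=> c; rewrite /quot_pi /quot_repr reprK. Qed.

Lemma quot_piP (a b : A) : quot_pi a = quot_pi b <-> con_rel theta (a, b).
Proof.
split=> [/(@eqmodP _ con_equiv_rel)/asboolP //|ab].
by apply/(@eqmodP _ con_equiv_rel)/asboolP.
Qed.

Lemma quot_carrier_inhabited : inhabited quot_carrier.
Proof. by have [a] := carrier_inhabited A; exists; exact: quot_pi a. Qed.

(* Independent of the representatives: see [quot_opE]. *)
Definition quot_op (f : symbol S) (x : 'I_(arity f) -> quot_carrier) :
  quot_carrier := quot_pi (op (fun i => quot_repr (x i))).

Definition quotient : algebra S := Algebra quot_carrier_inhabited quot_op.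

Lemma quot_opE (f : symbol S) (x : 'I_(arity f) -> A) :
  @op S quotient f (fun i => quot_pi (x i)) = quot_pi (op x).
Proof.
apply/quot_piP; apply: congr_op (con_congr theta) _ _ _ _ => i.
by apply/quot_piP; rewrite quot_reprK.
Qed.

Definition quot_rel (alpha : con A) : set (quotient * quotient) :=
  [set (quot_pi p.1, quot_pi p.2) | p in con_rel alpha].

Lemma quot_relE (alpha : con A) (le_theta : (theta <= alpha)%O) (c d : quotient) :
  quot_rel alpha (c, d) <-> con_rel alpha (quot_repr c, quot_repr d).
Proof.
have [ar as_ at_ _] := con_congr alpha; split; last first.
  by move=> cd; exists (quot_repr c, quot_repr d) => //=; rewrite !quot_reprK.
have sub (a : A) : con_rel alpha (quot_repr (quot_pi a), a).
  by apply: (con_leP _ _ le_theta); apply/quot_piP; rewrite quot_reprK.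
move=> [[a b] /= ab] [<- <-].
exact: at_ (sub a) (at_ _ _ _ ab (as_ _ _ (sub b))).
Qed.

Lemma quot_rel_congr (alpha : con A) :
  (theta <= alpha)%O -> is_congruence (quot_rel alpha).
Proof.
move=> le_theta; have [ar as_ at_ ao] := con_congr alpha.
split=> [c|c d|c d e|f x y xy].
- by apply/quot_relE => //; exact: ar.
- by rewrite !quot_relE//; exact: as_.
- by rewrite !quot_relE//; exact: at_.
- exists (op (fun i => quot_repr (x i)), op (fun i => quot_repr (y i))) => //.
  by apply: ao => i; apply/quot_relE.
Qed.

Definition quot_con (alpha : con A) (le_theta : (theta <= alpha)%O) :
  con quotient := Con (quot_rel_congr le_theta).

Definition u_con (alpha : con A) : con quotient :=
  @quot_con (alpha `|` theta)%O (leUr theta alpha).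

(* When A is congruence-distributive, [u_con] maps [FC A] into [FC quotient], so
   [set_surj] is exactly surjectivity of the restriction FC(A) -> FC(A/theta). *)
Definition con_has_FCLP : Prop := set_surj (FC A) (FC quotient) u_con.

End Quotient.

Definition has_FCLP (S : signature) (A : algebra S) : Prop :=
  forall theta : con A, con_has_FCLP theta.

Definition FC_normal (S : signature) (A : algebra S) : Prop :=
  forall phi psi : con A, con_comp phi psi = [set: A * A] ->
    exists alpha beta : con A,
      [/\ FC A alpha, FC A beta, (alpha `&` beta)%O = \bot%O,
          con_comp phi alpha = [set: A * A]
        & con_comp psi beta = [set: A * A]].

(* Main.v *)
(** For both directions, factor congruences of [A/theta] are pulled back to
    congruences [phi, psi >= theta] of [A] with [phi `&` psi = theta] and
    [phi \; psi] full; lifting [phi / theta] means finding a factor congruence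
    [alpha] with [alpha `|` theta = phi].
    If [alpha] is such a lift for [theta := phi `&` psi], distributivity puts
    its complement below [psi], and the complementary pair witnesses
    FC-normality. Conversely, if [alpha `&` beta = \bot], [phi `|` alpha = \top]
    and [psi `|` beta = \top], then [phi = (phi `|` alpha) `&` (phi `|` beta)
    = phi `|` beta], so [beta <= phi], and
    [phi = phi `&` (beta `|` psi) = beta `|` theta]. *)
From mathcomp Require Import all_boot all_order.
From mathcomp Require Import boolp classical_sets.
Require Import Defs.

Set Implicit Arguments.
Unset Strict Implicit.
Unset Printing Implicit Defensive.

Import Order.Theory.
Local Open Scope classical_set_scope.
Local Open Scope order_scope.

Section CongruenceComposition.
Variables (S : signature) (A : algebra S).
Implicit Types (phi psi : con A).

Lemma con_compP phi psi (a b : A) :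
  con_comp phi psi (a, b) <->
  exists2 x, con_rel psi (a, x) & con_rel phi (x, b).
Proof. by split. Qed.

Lemma con_compS phi phi' psi psi' : phi <= phi' -> psi <= psi' ->
  con_comp phi psi `<=` con_comp phi' psi'.
Proof.
move=> /con_leP le_phi /con_leP le_psi [a b] /con_compP[x ax xb].
by apply/con_compP; exists x; [exact: le_psi|exact: le_phi].
Qed.

Lemma con_comp_setTC phi psi :
  con_comp phi psi = [set: A * A] -> con_comp psi phi = [set: A * A].
Proof.
move=> compT; apply/seteqP; split=> // -[a b] _.
have /con_compP[x bx xa] : con_comp phi psi (b, a) by rewrite compT.
by apply/con_compP; exists x; exact: congr_sym (con_congr _) _ _ _.
Qed.

Lemma con_comp_sub_join phi psi : con_comp phi psi `<=` con_rel (phi `|` psi).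
Proof.
move=> [a b] /con_compP[x ax xb].
apply: (congr_trans (con_congr (phi `|` psi)) (b := x)).
  exact: (con_leP _ _ (leUr psi phi)).
exact: (con_leP _ _ (leUl phi psi)).
Qed.

Lemma con_comp_setT_join phi psi :
  con_comp phi psi = [set: A * A] -> phi `|` psi = \top.
Proof.
move=> compT; apply: le_anti; rewrite lex1; apply/con_leP => p _.
by apply: con_comp_sub_join; rewrite compT.
Qed.

Lemma con_comp_congr phi psi :
  con_comp phi psi = con_comp psi phi -> is_congruence (con_comp phi psi).
Proof.
move=> compC; split=> [a|a b|a b c|f x y xy].
- by apply/con_compP; exists a; exact: congr_refl (con_congr _) _.
- rewrite {2}compC => /con_compP[x ax xb].
  by apply/con_compP; exists x; exact: congr_sym (con_congr _) _ _ _.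
- move=> /con_compP[x ax xb] /con_compP[y bpsiy yc].
  (* In the chain from [a] through [x], [b], [y] to [c], the two middle links come in the wrong
     order; permutability swaps them, and equal neighbours then merge by transitivity. *)
  have : con_comp psi phi (x, y) by apply/con_compP; exists b.
  rewrite -compC => /con_compP[z xz zy]; apply/con_compP; exists z.
    exact: (congr_trans (con_congr psi) ax xz).
  exact: (congr_trans (con_congr phi) zy yc).
- have /choice[z zP] i : exists z, con_rel psi (x i, z) /\ con_rel phi (z, y i).
    by have /con_compP[z] := xy i; exists z.
  by apply/con_compP; exists (op z); apply: congr_op (con_congr _) _ _ _ _ => i;
    have [] := zP i.
Qed.

(** When [phi] and [psi] permute, their composition is a congruence above both, hence above their
    join. *)
Lemma con_join_top_comp phi psi : con_comp phi psi = con_comp psi phi ->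
  phi `|` psi = \top -> con_comp phi psi = [set: A * A].
Proof.
move=> compC joinT; pose chi := Con (con_comp_congr compC).
have : phi `|` psi <= chi.
  rewrite leUx; apply/andP; split; apply/con_leP => -[a b] ab /=;
    apply/con_compP; [exists a|exists b] => //;
    exact: congr_refl (con_congr _) _.
by rewrite joinT => /con_leP chiT; apply/seteqP; split=> // p _; exact: chiT.
Qed.

(** A full composition stays full when reversed, so fullness alone encodes both the join condition
    and permutability. This is also the shape of the hypothesis of [FC_normal]. *)
Lemma factor_congruenceP phi : factor_congruence phi <->
  exists psi, phi `&` psi = \bot /\ con_comp phi psi = [set: A * A].
Proof.
split=> [[psi [joinT meet0 compC]]|[psi [meet0 compT]]]; exists psi.
  by split=> //; exact: con_join_top_comp.
by split=> //; [exact: con_comp_setT_join|rewrite compT (con_comp_setTC compT)].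
Qed.

End CongruenceComposition.

Section CongruenceDistributive.
Variables (S : signature) (A : algebra S).
Hypothesis A_distr : congruence_distributive A.
Implicit Types (phi psi theta : con A).

(** Distributivity is a hypothesis on [A], not part of the lattice structure of [con A]; the dual
    law follows from it by expansion and absorption. *)
Lemma con_joinIr phi psi theta :
  phi `|` (psi `&` theta) = (phi `|` psi) `&` (phi `|` theta).
Proof.
rewrite A_distr [_ `&` phi]meetC joinKI [(_ `|` _) `&` theta]meetC A_distr.
by rewrite joinA [theta `&` phi]meetC meetKU [theta `&` psi]meetC.
Qed.

Lemma complement_le_of_join alpha alpha' phi psi :
  alpha `|` (phi `&` psi) = phi -> alpha `&` alpha' = \bot ->
  phi `|` psi = \top -> alpha' <= psi.
Proof.
(* Split [alpha'] along the join of [phi] and [psi]. The part inside [phi] meets [alpha] trivially,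
   so by [lift] it lies below the meet of [phi] and [psi]. *)
move=> lift meet0 joinT; rewrite -[alpha']meetx1 -joinT A_distr leUx leIr andbT.
rewrite -lift A_distr [_ `&` alpha]meetC meet0 join0x.
by rewrite meetA leIr.
Qed.

Lemma join_of_meet_bot alpha beta phi psi :
  alpha `&` beta = \bot -> phi `|` alpha = \top -> psi `|` beta = \top ->
  beta `|` (phi `&` psi) = phi.
Proof.
move=> meet0 phiT psiT.
have /join_idPr le_phi : beta <= phi.
  by rewrite -[phi in leRHS]joinx0 -meet0 con_joinIr phiT meet1x leUr.
by rewrite con_joinIr le_phi [beta `|` _]joinC psiT meetx1.
Qed.

End CongruenceDistributive.

Section Pullback.
Variables (S : signature) (A : algebra S) (theta : con A).
Implicit Types (alpha : con A) (gamma delta : con (quotient theta)).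

Lemma pull_congr gamma : is_congruence
  [set p : A * A | con_rel gamma (quot_pi theta p.1, quot_pi theta p.2)].
Proof.
have [gr gs gt go] := con_congr gamma.
split=> [a|a b|a b c|f x y xy] /=; [exact: gr|exact: gs|exact: gt|].
by rewrite -!quot_opE; exact: go.
Qed.

Definition pull gamma : con A := Con (pull_congr gamma).

Lemma le_pull gamma : theta <= pull gamma.
Proof.
apply/con_leP => -[a b] /quot_piP /= ->; exact: congr_refl (con_congr gamma) _.
Qed.

Lemma pull_quot_con alpha (le_theta : theta <= alpha) :
  pull (quot_con le_theta) = alpha.
Proof.
apply: con_inj; apply/seteqP; split=> -[a b] /=; last by exists (a, b).
move=> [[c d] /= cd [/quot_piP ca /quot_piP db]].
have [_ as_ at_ _] := con_congr alpha; move/con_leP: le_theta => le_theta.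
exact: at_ (as_ _ _ (le_theta _ ca)) (at_ _ _ _ cd (le_theta _ db)).
Qed.

(** With [pull_quot_con], this is the correspondence theorem: equalities between congruences of the
    quotient can be checked in [con A]. *)
Lemma pull_inj : injective pull.
Proof.
move=> gamma delta /(congr1 (@con_rel _ _)) eq_pull.
apply: con_inj; apply/funext => -[c d]; rewrite -[c]quot_reprK -[d]quot_reprK.
exact: (congr1 (@^~ (quot_repr c, quot_repr d)) eq_pull).
Qed.

Lemma pull_u_con alpha : pull (u_con theta alpha) = alpha `|` theta.
Proof. exact: pull_quot_con. Qed.

Lemma pull_meet gamma delta : pull (gamma `&` delta) = pull gamma `&` pull delta.
Proof. exact: con_inj. Qed.

Lemma pull_bot : pull \bot = theta.
Proof. by apply: con_inj; apply/seteqP; split=> -[a b] /quot_piP. Qed.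

(** Together with [pull_meet] and [pull_bot], this transports the criterion [factor_congruenceP]
    along [pull] without computing pullbacks of joins. *)
Lemma pull_comp_setT gamma delta :
  con_comp (pull gamma) (pull delta) = [set: A * A] <->
  con_comp gamma delta = [set: quotient theta * quotient theta].
Proof.
split=> compT; apply/seteqP; split=> // -[a b] _.
  have /con_compP[x ax xb] :
      con_comp (pull gamma) (pull delta) (quot_repr a, quot_repr b).
    by rewrite compT.
  by apply/con_compP; exists (quot_pi theta x);
    [move: ax|move: xb]; rewrite /= quot_reprK.
have /con_compP[x ax xb] :
  con_comp gamma delta (quot_pi theta a, quot_pi theta b) by rewrite compT.
by apply/con_compP; exists (quot_repr x); rewrite /= quot_reprK.
Qed.

End Pullback.

Theorem proposition3p20 (S : signature) (A : algebra S)
  (A_distr : congruence_distributive A) :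
  has_FCLP A <-> FC_normal A.
Proof.
split=> [lifts phi psi compT|normal theta gamma /factor_congruenceP].
  pose theta := phi `&` psi.
  pose gamma := quot_con (leIl phi psi : theta <= phi).
  have FCgamma : FC (quotient theta) gamma.
    apply/factor_congruenceP; exists (quot_con (leIr psi phi : theta <= psi)).
    split; last by apply/pull_comp_setT; rewrite !pull_quot_con.
    by apply: pull_inj; rewrite pull_meet pull_bot !pull_quot_con.
  have [alpha FCalpha /(congr1 (@pull _ _ _))] := lifts _ _ FCgamma.
  rewrite pull_u_con pull_quot_con => lift.
  have /factor_congruenceP[alpha' [meet0 alphaT]] := FCalpha.
  have alpha'T := con_comp_setTC alphaT.
  have le_phi : alpha <= phi by rewrite -lift leUl.
  have le_psi : alpha' <= psi.
    exact: (complement_le_of_join A_distr lift meet0 (con_comp_setT_join compT)).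
  (* The pair is crossed: [alpha <= phi], so enlarging [alpha] to [phi] keeps its composition with
     [alpha'] full; symmetrically, [alpha'] is enlarged to [psi]. *)
  exists alpha', alpha; split=> //.
  - by apply/factor_congruenceP; exists alpha; rewrite meetC.
  - by rewrite meetC.
  - by apply/seteqP; split=> // p _;
      apply: (con_compS le_phi (lexx alpha')); rewrite alphaT.
  - by apply/seteqP; split=> // p _;
      apply: (con_compS le_psi (lexx alpha)); rewrite alpha'T.
move=> [delta [meet0 /pull_comp_setT compT]].
have [alpha [beta [_ FCbeta ab0 phiT psiT]]] := normal _ _ compT.
(* The lift is [beta], since it is the one lying below [pull gamma]. To compare in [con A], [theta]
   is rewritten as the meet of [pull gamma] and [pull delta]. *)
exists beta => //; apply: pull_inj.
rewrite pull_u_con -[in X in _ `|` X](pull_bot theta) -meet0 pull_meet.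
exact: (join_of_meet_bot A_distr ab0 (con_comp_setT_join phiT)
  (con_comp_setT_join psiT)).
Qed.
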